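(* Let $1<p<\infty$, let $\sigma$ be a Borel probability measure on $\mathbb{S}^{d-1}$, and let $\mu^1,\mu^2$ be discrete probability measures on $\mathbb{R}^d$ with finite $p$-th moment. Then the expected sliced transport plan $\bar\gamma^{\mu^1,\mu^2}$ belongs to $\Gamma(\mu^1,\mu^2)$, i.e. it is a probability measure on $\mathbb{R}^d\times\mathbb{R}^d$ with first marginal $\mu^1$ and second marginal $\mu^2$.
   Context: A discrete probability measure is one concentrated on a finite or countable set. For $\theta\in\mathbb{S}^{d-1}$ and a probability measure $\mu$ on $\mathbb{R}^d$, $\theta_\#\mu$ denotes the pushforward of $\mu$ under $x\mapsto\theta\cdot x$, a probability measure on $\mathbb{R}$. For discrete probability measures $\mu^1=\sum_x p(x)\delta_x$, $\mu^2=\sum_y q(y)\delta_y$ on $\mathbb{R}^d$ (so $p(x)=\mu^1(\{x\})$, $q(y)=\mu^2(\{y\})$), let $\Lambda_\theta^{\mu^1,\mu^2}$ be the unique optimal transport plan between $\theta_\#\mu^1$ and $\theta_\#\mu^2$ on $\mathbb{R}\times\mathbb{R}$ for the cost $|u-v|^p$. Put $P_\theta(x)=\sum_{x':\theta\cdot x'=\theta\cdot x}p(x')$ and $Q_\theta(y)=\sum_{y':\theta\cdot y'=\theta\cdot y}q(y')$. The lifted plan is the discrete measure $\gamma_\theta^{\mu^1,\mu^2}$ on $\mathbb{R}^d\times\mathbb{R}^d$ with $$\gamma_\theta^{\mu^1,\mu^2}(\{(x,y)\})=\frac{p(x)q(y)}{P_\theta(x)Q_\theta(y)}\,\Lambda_\theta^{\mu^1,\mu^2}(\{(\theta\cdot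 x,\theta\cdot y)\})$$ if $p(x)\neq0$ and $q(y)\ne0$, and $0$ otherwise. The expected sliced transport plan is the discrete measure $\bar\gamma^{\mu^1,\mu^2}$ with $\bar\gamma^{\mu^1,\mu^2}(\{(x,y)\})=\int_{\mathbb{S}^{d-1}}\gamma_\theta^{\mu^1,\mu^2}(\{(x,y)\})\,d\sigma(\theta)$. *)

(* Defs.v *)
From HB Require Import structures.
From mathcomp Require Import all_boot all_order all_algebra.
From mathcomp Require Import all_classical all_reals all_analysis.

Set Implicit Arguments.
Unset Strict Implicit.
Unset Printing Implicit Defensive.
Import Order.TTheory GRing.Theory Num.Theory.
Import numFieldNormedType.Exports.

Local Open Scope classical_set_scope.
Local Open Scope ring_scope.

(* R^d is [d.-tuple R]; the library equips it with the product sigma-algebra,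
   which is the Borel sigma-algebra of R^d. *)

Section euclidean.
Context {R : realType} {d : nat}.
Implicit Types theta x y : d.-tuple R.

Definition dot theta x : R := \sum_(i < d) tnth theta i * tnth x i.

Definition enorm x : R := Num.sqrt (dot x x).

Definition sphere : set (d.-tuple R) := [set theta | enorm theta = 1].

Lemma measurable_dot theta : measurable_fun [set: d.-tuple R] (dot theta).
Proof.
rewrite /dot; apply: measurable_sum => i.
by apply: measurable_realfun.measurable_funM; [exact: measurable_cst | exact: measurable_tnth].
Qed.

HB.instance Definition _ theta :=
  isMeasurableFun.Build _ _ _ _ (dot theta) (measurable_dot theta).

End euclidean.

Section discrete_measure.
Local Open Scope ereal_scope.
Context {disp : measure_display} {T : measurableType disp} {R : realType}.

(* The measure \sum_x m(x) \delta_x. *)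
Definition discrete_measure (m : T -> \bar R) (m_ge0 : forall x, 0 <= m x)
  : set T -> \bar R := fun A => \esum_(x in A) m x.

Variables (m : T -> \bar R) (m_ge0 : forall x, 0 <= m x).

Let discrete_measure0 : discrete_measure m_ge0 set0 = 0.
Proof. exact: esum_set0. Qed.

Let discrete_measure_ge0 A : 0 <= discrete_measure m_ge0 A.
Proof. by apply: esum_ge0 => x _; exact: m_ge0. Qed.

Let discrete_measure_sigma_additive :
  semi_sigma_additive (discrete_measure m_ge0).
Proof.
move=> F mF tF mUF; rewrite /discrete_measure esum_bigcupT//.
rewrite -nneseries_esumT; last by move=> n; exact: discrete_measure_ge0.
by apply: is_cvg_nneseries => n _ _; exact: discrete_measure_ge0.
Qed.

HB.instance Definition _ := isMeasure.Build _ _ _ (discrete_measure m_ge0)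
  discrete_measure0 discrete_measure_ge0 discrete_measure_sigma_additive.

Definition is_discrete (mu : {measure set T -> \bar R}) : Prop :=
  exists2 S : set T, countable S & mu (~` S) = 0.

End discrete_measure.

(* Gamma(mu, nu): probability measures with marginals mu and nu. *)
Definition coupling {d1 d2 : measure_display}
    {T1 : measurableType d1} {T2 : measurableType d2} {R : realType}
    (mu : probability T1 R) (nu : probability T2 R)
    : set {measure set (T1 * T2) -> \bar R} :=
  [set g | [/\ g setT = 1%E,
      forall A, measurable A -> pushforward g fst A = mu A &
      forall B, measurable B -> pushforward g snd B = nu B]].

Definition finite_moment {R : realType} {d : nat} (p : R)
    (mu : probability (d.-tuple R) R) : Prop :=
  (\int[mu]_x ((enorm x) `^ p)%:E < +oo)%E.

Section one_dimensional_transport.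
Context {R : realType}.

Definition transport_cost (p : R) (L : {measure set (R * R) -> \bar R})
    : \bar R :=
  (\int[L]_z (`|z.1 - z.2| `^ p)%:E)%E.

Definition optimal_plans (p : R) (mu nu : probability R R)
    : set (probability (R * R)%type R) :=
  [set L | coupling mu nu L /\
    forall L' : probability (R * R)%type R, coupling mu nu L' ->
      (transport_cost p L <= transport_cost p L')%E].

(* The unique element of [optimal_plans p mu nu]; [get] returns an unspecified
   value only if that set is empty, which does not happen when 1 < p and mu, nu
   have finite p-th moments. *)
Definition optimal_plan (p : R) (mu nu : probability R R)
    : probability (R * R)%type R :=
  get (optimal_plans p mu nu).

End one_dimensional_transport.

Section expected_sliced_plan.
Context {R : realType} {d : nat}.
Local Notation E := (d.-tuple R).
Variables (p : R) (mu1 mu2 : probability E R).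
Implicit Types (theta x y : E).

Definition mass (mu : probability E R) x : R := fine (mu [set x]).

(* P_theta(x) and Q_theta(y) *)
Definition fiber_mass (mu : probability E R) theta x : R :=
  fine (\esum_(x' in [set x' | dot theta x' = dot theta x]) mu [set x'])%E.

(* [distribution mu (dot theta)] is the pushforward of mu under [dot theta]. *)
Definition sliced_optimal_plan theta :=
  optimal_plan p (distribution mu1 (dot theta)) (distribution mu2 (dot theta)).

Definition lifted_mass theta (z : E * E) : \bar R :=
  if (mass mu1 z.1 != 0) && (mass mu2 z.2 != 0) then
    ((mass mu1 z.1 * mass mu2 z.2 /
       (fiber_mass mu1 theta z.1 * fiber_mass mu2 theta z.2))%:E *
     sliced_optimal_plan theta [set (dot theta z.1, dot theta z.2)])%E
  else 0%E.

Lemma lifted_mass_ge0 theta z : (0 <= lifted_mass theta z)%E.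
Proof.
rewrite /lifted_mass; case: ifP => // _; apply: mule_ge0 => //.
rewrite lee_fin divr_ge0 ?mulr_ge0//; apply: fine_ge0 => //.
- by apply: esum_ge0.
- by apply: esum_ge0.
Qed.

Definition lifted_plan theta : {measure set (E * E) -> \bar R} :=
  discrete_measure (lifted_mass_ge0 theta).

Definition expected_mass (sigma : probability E R) (z : E * E) : \bar R :=
  (\int[sigma]_(theta in sphere) lifted_plan theta [set z])%E.

Lemma expected_mass_ge0 sigma z : (0 <= expected_mass sigma z)%E.
Proof. by apply: integral_ge0 => theta _; exact: measure_ge0. Qed.

Definition expected_sliced_plan (sigma : probability E R)
    : {measure set (E * E) -> \bar R} :=
  discrete_measure (expected_mass_ge0 sigma).

End expected_sliced_plan.

(* Main.v *)
(** Everything rests on the one-dimensional transport problem.  For [u <> v], the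
    number [|u - v|^p] is the Lebesgue measure of the set of [(t, r)], [r > 0], such
    that the two points lie on both sides of [t], the lower one at distance at least
    [k r := (r / p)^(1 / (p - 1))] below [t].  By Tonelli, with [s = t - k r], the cost
    of a coupling [L] of [P] and [Q] is the integral over [(t, r)] of
      [L (u <= s, v > t) + L (v <= s, u > t)
        = (F s - H (s, t)) + (G s - H (t, s))],
    where [F], [G], [H] are the distribution functions of [P], [Q], [L].  Since
    [H (s, t) <= min (F s) (G t)], with equality for the quantile coupling, the latter
    is optimal; when its cost is finite, every optimal plan has the joint distribution
    function [min (F s) (G t)], because a strict inequality at one point would persist
    on a set of [(t, r)] of positive measure.

    Consequently the mass which the optimal plan of the [theta]-slices gives to a
    point is a limit of expressions in slice distribution functions, hence measurable
    in [theta], and sums over the countably many atoms can be exchanged with the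
    integral over the sphere.  For a fixed [theta], summing the lifted masses over a
    fiber of [dot theta] cancels the factor [Q_theta], and summing the result over
    the fibers gives a marginal of the optimal plan. *)

From HB Require Import structures.
Require Import Defs.
From mathcomp Require Import all_boot all_order all_algebra.
From mathcomp Require Import all_classical all_reals all_analysis.
From mathcomp Require Import measurable_realfun ring lra.
Import Order.TTheory GRing.Theory Num.Theory.
Import numFieldNormedType.Exports.

Set Implicit Arguments.
Unset Strict Implicit.
Unset Printing Implicit Defensive.

Local Open Scope classical_set_scope.
Local Open Scope ring_scope.

(** * Quantile functions and the monotone coupling *)

(** The open rays []x, +oo[] form a pi-system generating the Borel sets; their masses follow by
    complement from the total mass, and the rays []-n, +oo[] exhaust the line. *)
Lemma probability_rays_unique {R : realType} (m1 m2 : {measure set R -> \bar R}) :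
  m1 setT = 1%E -> m2 setT = 1%E ->
  (forall s : R, m1 `]-oo, s]%classic = m2 `]-oo, s]%classic) ->
  forall A, measurable A -> m1 A = m2 A.
Proof.
move=> m1T m2T m12 A mA.
have fin (m : {measure set R -> \bar R}) B : m setT = 1%E -> measurable B -> (m B < +oo)%E.
  move=> mT mB; apply: (@le_lt_trans _ _ (m setT)); last by rewrite mT ltry.
  by apply: le_measure => //; rewrite inE.
apply: (@measure_unique _ R _ (@RGenOInfty.G R)
    (fun n => `](- n%:R), +oo[%classic)) => //.
- exact: RGenOInfty.measurableE.
- move=> _ _ [x ->] [y ->]; exists (Num.max x y).
  apply/seteqP; split => z /=; rewrite !in_itv/= !andbT gt_max; first by case=> -> ->.
  by move/andP.
- by move=> i; exists (- i%:R).
- apply/seteqP; split => // x _; exists (Num.truncn `|x|).+1 => //=.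
  rewrite in_itv/= andbT ltrNl; apply: (le_lt_trans (ler_norm _)).
  by rewrite normrN truncnS_gt.
- move=> _ [x ->].
  rewrite -setCitvl -[X in m1 X]setTD -[X in m2 X]setTD !measureD//; [|exact: fin..].
  rewrite !setTI; congr (_ - _)%E; last exact: m12.
  exact: etrans m1T (esym m2T).
- by move=> k; exact: fin.
Qed.

Section rcdf.
Context {R : realType} (P : probability R R).

(** The identity as a random variable, through which facts on cumulative distribution functions of
    random variables pass to [rcdf]. *)
Let idR : R -> R := idfun.
HB.instance Definition _ := isMeasurableFun.Build _ _ _ _ idR (@measurable_id _ _ setT).

Definition rcdf (s : R) : R := fine (P `]-oo, s]%classic).

Lemma rcdfE s : P `]-oo, s]%classic = (rcdf s)%:E.
Proof. by rewrite fineK// fin_num_measure//; exact: measurable_itv. Qed.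

Lemma rcdf_nd : {homo rcdf : x y / x <= y}.
Proof.
move=> x y xy; rewrite -lee_fin -!rcdfE le_measure ?inE//.
by apply: subset_itvl; rewrite bnd_simp.
Qed.

Lemma rcdf_rc : right_continuous rcdf.
Proof.
move=> s.
have := @cdf_right_continuous _ _ _ P (idR : {RV P >-> R}) s.
by rewrite /continuous_at/= -[X in _ --> X]/(P _) rcdfE => /fine_cvg.
Qed.

Lemma rcdf_ge (r : R) : r < 1 -> exists s, r <= rcdf s.
Proof.
move=> r1; have := @cvg_cdfy1 _ _ _ P (idR : {RV P >-> R}).
move=> /fine_cvg/cvgr_ge/(_ _ r1)/filter_ex[s rs].
by exists s.
Qed.

Lemma rcdf_lt (r : R) : 0 < r -> exists s, rcdf s < r.
Proof.
move=> r0; have := @cvg_cdfNy0 _ _ _ P (idR : {RV P >-> R}).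
move=> /fine_cvg/cvgr_lt/(_ _ r0)/filter_ex[s rs].
by exists s.
Qed.

(** The generalised inverse of [rcdf]. The default 0 is taken outside []0, 1[], a null set for
    [unit_measure] below. *)
Definition quantile (r : R) : R :=
  if (0 < r) && (r < 1) then inf [set s | r <= rcdf s] else 0.

(** The Galois connection between [quantile] and [rcdf]: right continuity puts the infimum in the
    set. Every later computation with quantiles rests on it. *)
Lemma quantile_le (r s : R) : 0 < r -> r < 1 -> (quantile r <= s) = (r <= rcdf s).
Proof.
move=> r0 r1; rewrite /quantile r0 r1/=; set A := [set s | _].
have hA : has_inf A.
  split; first exact: rcdf_ge.
  have [s' s'r] := rcdf_lt r0; exists s' => y/= ry.
  rewrite leNgt; apply/negP => /ltW/rcdf_nd ys'.
  by have := le_lt_trans (le_trans ry ys') s'r; rewrite ltxx.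
apply/idP/idP => [infs|rs]; last by apply: ge_inf => //; exact: hA.2.
rewrite leNgt; apply/negP => sr.
have := @rcdf_rc s => /cvgr_lt/(_ _ sr) H.
have [y [ys]] : exists y, s < y /\ rcdf y < r.
  apply: (@filter_ex _ (s^'+)); apply: filterI => //.
  exact: nbhs_right_gt.
move=> yr; have [z Az zy] : exists2 z, A z & z < y.
  by apply: inf_lt; [exact: hA.1|exact: le_lt_trans ys].
have := lt_le_trans yr (le_trans Az (rcdf_nd (ltW zy))).
by rewrite ltxx.
Qed.

Lemma measurable_quantile : measurable_fun setT quantile.
Proof.
apply: (measurability (@RGenOInfty.G R)); first exact: RGenOInfty.measurableE.
move=> /= _ [_ [s ->] <-]; rewrite setTI -setCitvl -preimage_setC.
apply: measurableC.
(* Outside []0, 1[] the quantile is constantly 0, so the preimage contains all of that region or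
   none of it, according to the sign of [s]. *)
rewrite (_ : _ @^-1` _ = (`]0, 1[ `&` `]-oo, rcdf s]) `|`
    (~` `]0, 1[ `&` [set _ | 0 <= s])).
  apply: measurableU; apply: measurableI => //; first exact: measurableC.
  by have [s0|s0] := leP 0 s; [rewrite set_true|rewrite set_false].
apply/seteqP; split => r /=; rewrite !in_itv/=.
- case: (boolP ((0 < r) && (r < 1))) => [/andP[r0 r1]|r01].
    by rewrite quantile_le//; left.
  by rewrite /quantile (negbTE r01); right.
- case => [[/andP[r0 r1]]|[/negP/negbTE r01]]; first by rewrite quantile_le.
  by rewrite /quantile r01.
Qed.

End rcdf.

Section open_unit_interval.
Context {R : realType}.

Definition unit_measure : set (measurableTypeR R) -> \bar R :=
  mrestr (@lebesgue_measure R) (measurable_itv `]0, 1[).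

HB.instance Definition _ := Measure.on unit_measure.

Lemma unit_measure_setT : unit_measure setT = 1%E.
Proof.
by rewrite /unit_measure /mrestr setTI lebesgue_measure_itv/= lte_fin ltr01 -EFinD subr0.
Qed.

HB.instance Definition _ :=
  Measure_isProbability.Build _ _ _ unit_measure unit_measure_setT.

End open_unit_interval.

Lemma rcdf_bounds {R : realType} (P : probability R R) s : 0 <= rcdf P s <= 1.
Proof. by rewrite -!lee_fin -rcdfE measure_ge0 probability_le1. Qed.

Section monotone_plan.
Context {R : realType} (P Q : probability R R).

Definition quantile_pair (r : measurableTypeR R) : R * R :=
  (quantile P r, quantile Q r).

Lemma measurable_quantile_pair : measurable_fun setT quantile_pair.
Proof. by apply: measurable_fun_pair; exact: measurable_quantile. Qed.

HB.instance Definition _ :=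
  isMeasurableFun.Build _ _ _ _ quantile_pair measurable_quantile_pair.

(** The comonotone coupling: both quantile functions are driven by one uniform variable. *)
Definition monotone_plan : probability (R * R)%type R :=
  distribution (@unit_measure R) quantile_pair.

Lemma monotone_planE s t :
  monotone_plan (`]-oo, s] `*` `]-oo, t]) = (Num.min (rcdf P s) (rcdf Q t))%:E.
Proof.
rewrite /monotone_plan /distribution /pushforward /= /unit_measure /mrestr.
set m := Num.min _ _.
have m0 : 0 <= m by rewrite le_min; case/andP: (rcdf_bounds P s) => ->; case/andP: (rcdf_bounds Q t) => ->.
have m1 : m <= 1 by rewrite ge_min; case/andP: (rcdf_bounds P s) => _ ->.
(* By [quantile_le] the quadrant pulls back to the [r <= m] in []0, 1[]. If [m = 1] this is []0,
   1[], open on the right because [unit_measure] discards the point 1; otherwise it is []0, m]]. *)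
rewrite (_ : _ `&` _ = [set` Interval (BRight 0) (if m < 1 then BRight m else BLeft 1)]).
  rewrite lebesgue_measure_itv/=; case: (ltP m 1) => [mlt|mge]/=.
    rewrite lte_fin; case: ltP => [_|mle]; first by rewrite -EFinD subr0.
    by congr (_%:E); apply/eqP; rewrite eq_le mle m0.
  by rewrite lte_fin ltr01 -EFinD subr0; congr (_%:E); apply/eqP; rewrite eq_le mge m1.
apply/seteqP; split => r /=; rewrite !in_itv/=.
  move=> [[/= +] + /andP[r0 r1]]; rewrite !quantile_le// => rP rQ.
  have rm : r <= m by rewrite le_min rP rQ.
  by case: (ltP m 1) => _; rewrite /= ?in_itv/= ?r0.
case: (ltP m 1) => [mlt|mge] /=; rewrite ?in_itv/= => /andP[r0 rm].
  have r1 := le_lt_trans rm mlt; rewrite r0 r1 !quantile_le//; split => //.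
  by apply/andP; rewrite -le_min.
rewrite r0 rm !quantile_le//; split => //.
by apply/andP; rewrite -le_min (le_trans (ltW rm)).
Qed.

End monotone_plan.

(** * Couplings through their joint distribution functions *)

Section coupling_facts.
Context {R : realType} (P Q : probability R R) (L : probability (R * R)%type R).

Definition jcdf s t : R := fine (L (`]-oo, s] `*` `]-oo, t])).

Lemma jcdfE s t : L (`]-oo, s] `*` `]-oo, t]) = (jcdf s t)%:E.
Proof. by rewrite fineK// fin_num_measure//; exact: measurableX. Qed.

Lemma jcdf_nd s s' t t' : s <= s' -> t <= t' -> jcdf s t <= jcdf s' t'.
Proof.
move=> ss' tt'; rewrite -lee_fin -!jcdfE le_measure ?inE//; [exact: measurableX..|].
by apply: setSX; apply: subset_itvl; rewrite bnd_simp.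
Qed.

Hypothesis cL : coupling P Q L.

Lemma coupling_fst (A : set R) : measurable A -> L (A `*` [set: R]) = P A.
Proof. by case: cL => _ /(_ A) + _ => /[apply] <-; rewrite /pushforward setXT. Qed.

Lemma coupling_snd (B : set R) : measurable B -> L ([set: R] `*` B) = Q B.
Proof. by case: cL => _ _ /(_ B) => /[apply] <-; rewrite /pushforward setTX. Qed.

(** The Frechet-Hoeffding bound: a quadrant lies in two half-planes whose masses are prescribed by
    the marginals. *)
Lemma jcdf_le_min s t : jcdf s t <= Num.min (rcdf P s) (rcdf Q t).
Proof.
rewrite le_min -!lee_fin -!rcdfE -jcdfE.
rewrite -[X in (_ <= X)%E && _]coupling_fst// -[X in _ && (_ <= X)%E]coupling_snd//.
by apply/andP; split; apply: le_measure; rewrite ?inE//;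
  do ?[exact: measurableX]; apply: setSX.
Qed.

(** A half-plane minus a lower-left quadrant. This and its mirror image below evaluate the two
    pieces of a crossing slice. *)
Lemma coupling_lower_right s t :
  L (`]-oo, s] `*` `]t, +oo[) = (rcdf P s - jcdf s t)%:E.
Proof.
have -> : `]-oo, s] `*` `]t, +oo[ =
    (`]-oo, s] `*` [set: R]) `\` (`]-oo, s] `*` `]-oo, t]) :> set (R * R).
  rewrite -setCitvl; apply/seteqP; split => -[x y]/=; first by move=> [? ?]; split => // -[].
  by move=> [[xs _] xy]; split => // yt; exact: xy.
rewrite measureD; [|exact: measurableX..|]; last first.
  by rewrite -ge0_fin_numE// fin_num_measure//; exact: measurableX.
rewrite setIidr; last exact: setSX.
by rewrite EFinB -rcdfE; congr (_ - _)%E; [exact: coupling_fst|exact: jcdfE].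
Qed.

Lemma coupling_upper_left s t :
  L (`]s, +oo[ `*` `]-oo, t]) = (rcdf Q t - jcdf s t)%:E.
Proof.
have -> : `]s, +oo[ `*` `]-oo, t] =
    ([set: R] `*` `]-oo, t]) `\` (`]-oo, s] `*` `]-oo, t]) :> set (R * R).
  rewrite -setCitvl; apply/seteqP; split => -[x y]/=; first by move=> [? ?]; split => // -[].
  by move=> [[_ yt] xy]; split => // xs; exact: xy.
rewrite measureD; [|exact: measurableX..|]; last first.
  by rewrite -ge0_fin_numE// fin_num_measure//; exact: measurableX.
rewrite setIidr; last exact: setSX.
by rewrite EFinB -rcdfE; congr (_ - _)%E; [exact: coupling_snd|exact: jcdfE].
Qed.

End coupling_facts.

(** Read off from the coupling of [P] with itself, where the two constraints at [(s, s)]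
    coincide. *)
Lemma unit_measure_quantile {R : realType} (P : probability R R) s :
  unit_measure [set r | quantile P r <= s] = (rcdf P s)%:E.
Proof.
have -> : (rcdf P s)%:E = monotone_plan P P (`]-oo, s] `*` `]-oo, s]).
  by rewrite monotone_planE minxx.
rewrite /monotone_plan /distribution /pushforward; congr (unit_measure _).
by apply/seteqP; split => r; rewrite /quantile_pair/= !in_itv/=; [|case].
Qed.

Section monotone_coupling.
Context {R : realType} (P Q : probability R R).

(** Each marginal is the law of one quantile function, which has the right mass on every ray by
    [unit_measure_quantile]. *)
Lemma monotone_plan_coupling : coupling P Q (monotone_plan P Q).
Proof.
split; first exact: probability_setT.
- pose X : {RV (monotone_plan P Q) >-> R} := HB.pack (@fst R R)
    (isMeasurableFun.Build _ _ _ _ (@fst R R) (@measurable_fst _ _ _ _)).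
  move=> A; have := @probability_rays_unique _ (distribution (monotone_plan P Q) X) P.
  apply; [exact: probability_setT..|] => s.
  apply: etrans (esym (rcdfE _ s)); rewrite -unit_measure_quantile; congr (unit_measure _).
- pose X : {RV (monotone_plan P Q) >-> R} := HB.pack (@snd R R)
    (isMeasurableFun.Build _ _ _ _ (@snd R R) (@measurable_snd _ _ _ _)).
  move=> A; have := @probability_rays_unique _ (distribution (monotone_plan P Q) X) Q.
  apply; [exact: probability_setT..|] => s.
  apply: etrans (esym (rcdfE _ s)); rewrite -unit_measure_quantile; congr (unit_measure _).
Qed.

Lemma jcdf_monotone_plan s t :
  jcdf (monotone_plan P Q) s t = Num.min (rcdf P s) (rcdf Q t).
Proof. by rewrite /jcdf monotone_planE. Qed.

End monotone_coupling.

(** * The cost as the area of a crossing set *)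

Section powR_integral.
Context {R : realType}.
Implicit Types (q u v : R).

Lemma cvg_powR_subr q u : 0 < q -> (t - u) `^ q @[t --> u^'+] --> (u - u) `^ q.
Proof.
move=> q0; rewrite subrr powR0 ?gt_eqF//.
apply/cvgrPdist_lt => e e0; apply/nbhs_right0P; near=> a.
rewrite (addrC u) addrK; near: a.
by have /cvgrPdist_lt/(_ _ e0) := powR_cvg0 q0.
Unshelve. end_near. Qed.

Lemma is_derive_powR_subr q u t : u < t ->
  is_derive t 1 (fun t => (t - u) `^ q) (q * (t - u) `^ (q - 1)).
Proof.
move=> ut; have tu0 : 0 < t - u by rewrite subr_gt0.
have d1 : is_derive t 1 (fun t => t - u) 1.
  by apply: is_derive_eq; rewrite subr0.
have := @is_derive1_comp R (fun x => x `^ q) (fun t => t - u) t _ 1 (is_derive1_powR q tu0) d1.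
by rewrite mulr1.
Qed.

Lemma continuous_powR_subr q u t : u < t ->
  {for t, continuous (fun t => (t - u) `^ q)}.
Proof.
move=> ut; apply/differentiable_continuous/derivable1_diffP.
exact: (@ex_derive _ _ _ _ _ _ _ (is_derive_powR_subr q ut)).
Qed.

(** Fundamental theorem of calculus with antiderivative [(t - u) ^ q]; [1 < q] keeps the integrand
    continuous up to the endpoint [u]. *)
Lemma integral_powR_subr q u v : 1 < q -> u < v ->
  (\int[@lebesgue_measure R]_(t in `]u, v[) (q * (t - u) `^ (q - 1))%:E =
   ((v - u) `^ q)%:E)%E.
Proof.
move=> q1 uv; have q0 : 0 < q by exact: lt_trans q1.
have q10 : 0 < q - 1 by rewrite subr_gt0.
have cf : {within `[u, v], continuous (fun t => q * (t - u) `^ (q - 1))}.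
  apply/continuous_within_itvP => //; split.
  - move=> t; rewrite in_itv/= => /andP[ut _].
    by apply: cvgM; [exact: cvg_cst|exact: continuous_powR_subr].
  - by apply: cvgM; [exact: cvg_cst|exact: cvg_powR_subr].
  - apply: cvgM; [exact: cvg_cst|apply: cvg_at_left_filter].
    exact: continuous_powR_subr.
rewrite -(@integral_itv_bndoo _ u v _ true false); last first.
  apply/measurable_EFinP; apply: measurable_funM => //.
  apply: (@measurableT_comp _ _ _ _ _ _ (fun x => x `^ (q - 1))) => //.
  exact: measurable_funB.
rewrite (@continuous_FTC2 _ _ (fun t => (t - u) `^ q)) ?subrr ?powR0 ?gt_eqF//.
- by rewrite -EFinB subr0.
- split.
  + move=> t; rewrite in_itv/= => /andP[ut _].
    exact: (@ex_derive _ _ _ _ _ _ _ (is_derive_powR_subr q ut)).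
  + exact: cvg_powR_subr.
  + by apply: cvg_at_left_filter; exact: continuous_powR_subr.
- move=> t; rewrite in_itv/= => /andP[ut _]; rewrite derive1E.
  exact: (@derive_val _ _ _ _ _ _ _ (is_derive_powR_subr q ut)).
Qed.

End powR_integral.

Section lebesgue2.
Context {R : realType}.

(** Lebesgue measure of the plane, named so as to carry the sigma-finite structure needed for
    Tonelli. *)
Definition lebesgue2 : set (measurableTypeR R * measurableTypeR R) -> \bar R :=
  (@lebesgue_measure R \x @lebesgue_measure R)%E.

HB.instance Definition _ := Measure.on lebesgue2.

Lemma lebesgue2_sigma_finite : sigma_finite setT lebesgue2.
Proof.
pose I n : set (measurableTypeR R) := `[- n%:R, n%:R]%classic.
have mI n : measurable (I n) by exact: measurable_itv.
exists (fun n => I n `*` I n).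
  apply/seteqP; split => // -[x y] _.
  exists (Num.truncn (Num.max `|x| `|y|)).+1 => //.
  have := truncnS_gt (Num.max `|x| `|y|); rewrite gt_max => /andP[xn yn].
  by split; rewrite /I /= in_itv/= -ler_norml ltW.
move=> n; split; first exact: measurableX.
have Ioo : (@lebesgue_measure R (I n) < +oo)%E.
  by rewrite lebesgue_measure_itv/=; case: ifP => // _; rewrite -EFinB ltry.
by rewrite [ltLHS]product_measure1E//; apply: lte_mul_pinfty; rewrite ?ge0_fin_numE.
Qed.

HB.instance Definition _ :=
  Measure_isSigmaFinite.Build _ _ _ lebesgue2 lebesgue2_sigma_finite.

End lebesgue2.

Section crossing.
Context {R : realType}.
Variable p : R.
Hypothesis p1 : 1 < p.

Local Notation mu := (@lebesgue_measure R).

(** Over a pair of points [z.1], this is the region under the derivative of [t => (t - u) ^ p]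
    between the two points, where [u] is the lower one. *)
Definition crossing : set ((R * R) * (measurableTypeR R * measurableTypeR R)) :=
  [set z | (0 < z.2.2) &&
    ([&& z.1.1 < z.2.1, z.2.1 < z.1.2 & z.2.2 <= p * (z.2.1 - z.1.1) `^ (p - 1)] ||
     [&& z.1.2 < z.2.1, z.2.1 < z.1.1 & z.2.2 <= p * (z.2.1 - z.1.2) `^ (p - 1)])].

Lemma measurable_crossing : measurable crossing.
Proof.
pose T := ((R * R) * (measurableTypeR R * measurableTypeR R))%type.
have m11 : measurable_fun setT (fun z : T => z.1.1 : R).
  by apply: measurableT_comp => //; exact: measurable_fst.
have m12 : measurable_fun setT (fun z : T => z.1.2 : R).
  by apply: measurableT_comp => //; exact: measurable_fst.
have m21 : measurable_fun setT (fun z : T => z.2.1 : R).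
  by apply: measurableT_comp => //; exact: measurable_snd.
have m22 : measurable_fun setT (fun z : T => z.2.2 : R).
  by apply: measurableT_comp => //; exact: measurable_snd.
have mp (f g : T -> R) : measurable_fun setT f -> measurable_fun setT g ->
    measurable_fun setT (fun z => p * (f z - g z) `^ (p - 1)).
  move=> mf mg; apply: measurable_funM => //.
  apply: (@measurableT_comp _ _ _ _ _ _ (fun x => x `^ (p - 1))) => //.
  exact: measurable_funB.
suff : measurable_fun setT (fun z : T => (0 < z.2.2) &&
    ([&& z.1.1 < z.2.1, z.2.1 < z.1.2 & z.2.2 <= p * (z.2.1 - z.1.1) `^ (p - 1)] ||
     [&& z.1.2 < z.2.1, z.2.1 < z.1.1 & z.2.2 <= p * (z.2.1 - z.1.2) `^ (p - 1)])).
  by move=> /(_ measurableT [set true]); rewrite setTI; apply.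
apply: measurable_and; first exact: measurable_fun_ltr.
by apply: measurable_or; apply: measurable_and;
  do ?[apply: measurable_and]; do ?[exact: measurable_fun_ltr|apply: measurable_fun_ler => //; exact: mp].
Qed.

(** For [t] between [u] and [v] the vertical section is []0, p * (t - u) ^ (p - 1)]], whose length
    is the integrand of [integral_powR_subr]; elsewhere it is empty. *)
Lemma crossing_area_lt u v : u < v ->
  lebesgue2 (xsection crossing (u, v)) = ((v - u) `^ p)%:E.
Proof.
move=> uv; rewrite -integral_powR_subr// /lebesgue2 /product_measure1.
rewrite [RHS]integral_mkcond; apply: eq_integral => t _ /=.
rewrite patchE mem_setE in_itv/=.
rewrite (_ : xsection _ _ = if (u < t) && (t < v) then
    `]0, p * (t - u) `^ (p - 1)]%classic else set0); last first.
  apply/seteqP; split => r; rewrite /xsection /= !inE/= !inE /crossing/=.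
    case/andP => r0 /orP[] /and3P[ut tv rle]; last by have := lt_trans uv (lt_trans ut tv); rewrite ltxx.
    by rewrite ut tv/= in_itv/= r0.
  by case: ifPn => // /andP[-> ->] /=; rewrite in_itv/= => /andP[-> ->].
case: ifPn => // _; last by rewrite measure0.
rewrite lebesgue_measure_itv/= lte_fin; case: ltP; first by rewrite -EFinB subr0.
move=> H; congr (_%:E); apply/eqP; rewrite eq_le H.
by rewrite mulr_ge0 ?powR_ge0// (le_trans ler01)// ltW.
Qed.

Lemma xsection_crossingC u v : xsection crossing (u, v) = xsection crossing (v, u).
Proof.
by apply/seteqP; split => r; rewrite /xsection /= !inE/= /crossing/= orbC.
Qed.

Lemma crossing_area z :
  lebesgue2 (xsection crossing z) = (`|z.1 - z.2| `^ p)%:E.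
Proof.
case: z => u v /=; case: (ltgtP u v) => [uv|vu|->].
- by rewrite crossing_area_lt// distrC ger0_norm// subr_ge0 ltW.
- by rewrite xsection_crossingC crossing_area_lt// ger0_norm// subr_ge0 ltW.
- rewrite subrr normr0 powR0 ?gt_eqF ?(lt_trans _ p1)//.
  rewrite (_ : xsection _ _ = set0) ?measure0//; apply/seteqP; split => // r.
  rewrite /xsection /= !inE/= /crossing/=.
  by case/andP => _ /orP[] /and3P[a b]; have := lt_trans a b; rewrite ltxx.
Qed.

(** Tonelli for the indicator of [crossing]: integrating out [lebesgue2] first gives the cost by
    [crossing_area], integrating out [L] first gives the slices. *)
Lemma transport_cost_crossing (L : probability (R * R)%type R) :
  transport_cost p L = (\int[lebesgue2]_w L (ysection crossing w))%E.
Proof.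
rewrite /transport_cost.
under eq_integral do rewrite -crossing_area.
have := @indic_fubini_tonelli _ _ _ _ R L (@lebesgue2 R) _ measurable_crossing.
rewrite indic_fubini_tonelli_FE; last exact: measurable_crossing.
by rewrite indic_fubini_tonelli_GE; last exact: measurable_crossing.
Qed.

End crossing.

(** * Optimality and uniqueness of the monotone coupling *)

Section crossing_slices.
Context {R : realType}.
Variable p : R.
Hypothesis p1 : 1 < p.

(** The inverse of [a => p * a ^ (p - 1)] on the nonnegative reals. *)
Definition crossing_gap (r : R) : R := (r / p) `^ (p - 1)^-1.

Let p0 : 0 < p. Proof. exact: lt_trans p1. Qed.
Let q0 : 0 < p - 1. Proof. by rewrite subr_gt0. Qed.

Lemma crossing_gap_gt0 r : 0 < r -> 0 < crossing_gap r.
Proof. by move=> r0; rewrite powR_gt0// divr_gt0. Qed.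

Lemma crossing_gapK a : 0 <= a -> crossing_gap (p * a `^ (p - 1)) = a.
Proof.
move=> a0; rewrite /crossing_gap mulrC mulKf ?gt_eqF//.
by rewrite -powRrM divff ?gt_eqF// powRr1.
Qed.

Lemma crossing_gapKV r : 0 <= r -> p * crossing_gap r `^ (p - 1) = r.
Proof.
move=> r0; have rp0 : 0 <= r / p by rewrite divr_ge0// ltW.
rewrite /crossing_gap -powRrM mulVf ?gt_eqF// powRr1//.
by rewrite mulrC divfK// gt_eqF.
Qed.

Lemma crossing_gap_nd r r' : 0 <= r -> r <= r' -> crossing_gap r <= crossing_gap r'.
Proof.
move=> r0 rr'; apply: ge0_ler_powR; rewrite ?nnegrE ?divr_ge0 ?invr_ge0 ?(ltW q0) ?(ltW p0)//.
  exact: le_trans rr'.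
by rewrite ler_pM2r// invr_gt0.
Qed.

(** Inverting the height bound gives a lower bound on [t - u]; since the gap is positive, this also
    implies [u < t]. Slices thus become unions of quadrants. *)
Lemma le_crossing_gap r u t : 0 < r ->
  (u < t) && (r <= p * (t - u) `^ (p - 1)) = (u <= t - crossing_gap r).
Proof.
move=> r0; apply/idP/idP => [/andP[ut rle]|ule].
  have tu0 : 0 <= t - u by rewrite subr_ge0 ltW.
  rewrite lerBrDr addrC -lerBrDr -(crossing_gapK tu0).
  by apply: crossing_gap_nd => //; exact: ltW.
have tu : crossing_gap r <= t - u by rewrite lerBrDr addrC -lerBrDr.
have g0 := crossing_gap_gt0 r0.
rewrite -subr_gt0 (lt_le_trans g0 tu)/= -{1}(crossing_gapKV (ltW r0)).
rewrite ler_pM2l// ge0_ler_powR ?nnegrE ?(ltW q0) ?(ltW g0)//.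
by apply/ltW/(lt_le_trans g0).
Qed.

Lemma ysection_crossing t r : 0 < r ->
  ysection (crossing p) (t, r) =
  (`]-oo, t - crossing_gap r] `*` `]t, +oo[) `|`
  (`]t, +oo[ `*` `]-oo, t - crossing_gap r]).
Proof.
move=> r0; apply/seteqP; split => -[u v];
  rewrite /ysection /= in_setE /crossing/= !in_itv/= !andbT.
- case/andP => _ /orP[] /and3P[ut tv rle].
    by left; split => //; rewrite -le_crossing_gap// ut.
  by right; split => //; rewrite -le_crossing_gap// ut.
- rewrite r0/= => -[[us tv]|[tu vs]]; apply/orP; [left|right].
    by move: us; rewrite -le_crossing_gap// => /andP[-> ->]; rewrite tv.
  by move: vs; rewrite -le_crossing_gap// => /andP[-> ->]; rewrite tu.
Qed.

Lemma ysection_crossing0 t r : r <= 0 -> ysection (crossing p) (t, r) = set0.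
Proof.
move=> r0; apply/seteqP; split => // -[u v].
by rewrite /ysection /= !inE /crossing/= ltNge r0.
Qed.

Variables (P Q : probability R R).

(** The two pieces of the slice are disjoint because [s < t]; the second one is
    [coupling_upper_left] at [(t, s)]. *)
Lemma coupling_crossing (L : probability (R * R)%type R) t r : coupling P Q L ->
  0 < r -> let s := t - crossing_gap r in
  L (ysection (crossing p) (t, r)) =
  ((rcdf P s - jcdf L s t) + (rcdf Q s - jcdf L t s))%:E.
Proof.
move=> cL r0 s; transitivity (L ((`]-oo, s] `*` `]t, +oo[) `|` (`]t, +oo[ `*` `]-oo, s]))).
  by congr (L _); exact: ysection_crossing.
rewrite measureU; [|exact: measurableX..|].
  rewrite EFinD; congr (_ + _)%E.
    exact: (coupling_lower_right cL).
  exact: (coupling_upper_left cL).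
apply/seteqP; split => // -[u v] [[/= + tv] [/= tu vs]].
rewrite in_itv/= => us; move: tu; rewrite in_itv/= andbT.
by rewrite ltNge (le_trans us)// gerBl ltW// crossing_gap_gt0.
Qed.

(** Optimality slice by slice: [jcdf] enters [coupling_crossing] with a minus sign, and the monotone
    plan attains its upper bound. *)
Lemma crossing_monotone_plan_le (L : probability (R * R)%type R) w : coupling P Q L ->
  (monotone_plan P Q (ysection (crossing p) w) <= L (ysection (crossing p) w))%E.
Proof.
move=> cL; case: w => t r; have [r0|r0] := ltP 0 r; last first.
  by rewrite ysection_crossing0// !measure0.
rewrite (coupling_crossing _ cL)//.
rewrite (coupling_crossing _ (monotone_plan_coupling P Q))// lee_fin.
rewrite !jcdf_monotone_plan lerD// lerD2l lerN2; exact: jcdf_le_min.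
Qed.

Let measurable_crossing_slice (L : probability (R * R)%type R) :
  measurable_fun setT (fun w => L (ysection (crossing p) w)).
Proof. exact: measurable_fun_ysection (measurable_crossing p). Qed.

Lemma monotone_plan_optimal :
  optimal_plans p P Q (monotone_plan P Q).
Proof.
split; first exact: monotone_plan_coupling.
move=> L cL; rewrite !transport_cost_crossing//.
by apply: ge0_le_integral => // w _; exact: crossing_monotone_plan_le.
Qed.

End crossing_slices.

Section optimal_plan_unique.
Context {R : realType}.
Variable p : R.
Hypothesis p1 : 1 < p.
Variables (P Q : probability R R) (L : probability (R * R)%type R).
Hypothesis cL : coupling P Q L.
Hypothesis L_min : (transport_cost p L <= transport_cost p (monotone_plan P Q))%E.
Hypothesis cost_fin : (transport_cost p (monotone_plan P Q) < +oo)%E.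

Let q0 : 0 < p - 1. Proof. by rewrite subr_gt0. Qed.
Let p0 : 0 < p. Proof. exact: lt_trans p1. Qed.

(** The cost of [L] would exceed that of the monotone plan by at least [del] times a positive area.
    Two joint values are added because a crossing slice sees [(s, t)] and [(t, s)] together. *)
Lemma optimal_no_excess (s0 t0 e del : R) : s0 < t0 -> 0 < e -> 0 < del ->
  (forall s t, s0 <= s <= s0 + e -> t0 <= t <= t0 + e -> s < t ->
    jcdf L s t + jcdf L t s + del <=
    Num.min (rcdf P s) (rcdf Q t) + Num.min (rcdf P t) (rcdf Q s)) -> False.
Proof.
move=> st e0 del0 exc.
(* Chosen so that [2 e' <= e] and [e' < t0 - s0]; the latter makes [a0] positive. *)
pose e' := Num.min e (t0 - s0) / 2.
have e'0 : 0 < e' by rewrite divr_gt0// lt_min e0 subr_gt0.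
have e'e : e' *+ 2 <= e by rewrite -mulr_natr divfK// ge_min lexx.
have e'st : e' < t0 - s0.
  apply: (@lt_le_trans _ _ (e' *+ 2)); first by rewrite mulr2n ltrDl.
  by rewrite -mulr_natr divfK// ge_min lexx orbT.
(* Gaps in [[a0, a1]] and [t] in [[t0, t0 + e']] put [s] between [t0 - a1 = s0] and
   [t0 + e' - a0 = s0 + 2 e']. *)
pose a0 := t0 - s0 - e'; pose a1 := t0 - s0.
have a00 : 0 < a0 by rewrite subr_gt0.
have a01 : a0 < a1 by rewrite gtrBl.
pose r0 := p * a0 `^ (p - 1); pose r1 := p * a1 `^ (p - 1).
have r00 : 0 < r0 by rewrite mulr_gt0// powR_gt0.
have r01 : r0 < r1.
  by rewrite ltr_pM2l// gt0_ltr_powR// nnegrE ltW// (lt_trans a00).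
(* For [(t, r)] in [D], [s := t - crossing_gap p r] stays in [[s0, s0 + e]]. *)
pose D : set (measurableTypeR R * measurableTypeR R) :=
  `[t0, t0 + e']%classic `*` `[r0, r1]%classic.
have mD : measurable D by apply: measurableX; exact: measurable_itv.
have MD : lebesgue2 D = (e' * (r1 - r0))%:E.
  rewrite [LHS]product_measure1E//; try exact: measurable_itv.
  rewrite EFinM; congr (_ * _)%E; rewrite [LHS]lebesgue_measure_itv/= lte_fin.
    by rewrite ltrDl e'0 -EFinB addrAC subrr add0r.
  by rewrite r01.
pose f w := monotone_plan P Q (ysection (crossing p) w).
pose g w := L (ysection (crossing p) w).
have mf : measurable_fun setT f by exact: measurable_fun_ysection (measurable_crossing p).
have mg : measurable_fun setT g by exact: measurable_fun_ysection (measurable_crossing p).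
have fg w : (f w + del%:E * (\1_D w)%:E <= g w)%E.
  rewrite indicE; have [wD|wD] := boolP (w \in D); last first.
    by rewrite mule0 adde0; exact: crossing_monotone_plan_le.
  rewrite mule1; case: w wD => t r; rewrite inE => -[/=]; rewrite !in_itv/=.
  move=> /andP[tt0 tt1] /andP[rr0 rr1].
  have r_gt0 : 0 < r by exact: lt_le_trans rr0.
  have ga0 : a0 <= crossing_gap p r.
    by rewrite -(crossing_gapK p1 (ltW a00)); apply: crossing_gap_nd => //; exact: ltW.
  have ga1 : crossing_gap p r <= a1.
    rewrite -(crossing_gapK p1 (ltW (lt_trans a00 a01))).
    by apply: crossing_gap_nd => //; exact: ltW.
  rewrite /f /g (coupling_crossing p1 _ cL)//.
  rewrite (coupling_crossing p1 _ (monotone_plan_coupling P Q))//.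
  rewrite -EFinD lee_fin !jcdf_monotone_plan; set s := t - _.
  have := @exc s t; move: e'e ga0 ga1; rewrite /s /a0 /a1 mulr2n => e'e ga0 ga1.
  have -> : s0 <= t - crossing_gap p r <= s0 + e by lra.
  have -> : t0 <= t <= t0 + e by lra.
  have -> : t - crossing_gap p r < t by lra.
  move=> /(_ isT isT isT); lra.
have : (\int[lebesgue2]_w (f w + del%:E * (\1_D w)%:E) <= \int[lebesgue2]_w g w)%E.
  apply: ge0_le_integral => //.
  - by move=> w _; rewrite adde_ge0// mule_ge0// lee_fin ltW.
  - apply: emeasurable_funD => //; apply: measurable_funeM.
    by apply/measurable_EFinP; exact: measurable_indic.
rewrite ge0_integralD//; last 2 first.
- by move=> w _; rewrite mule_ge0// lee_fin ltW.
- by apply: measurable_funeM; apply/measurable_EFinP; exact: measurable_indic.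
rewrite ge0_integralZl_EFin//; last 2 first.
- by apply/measurable_EFinP; exact: measurable_indic.
- exact: ltW.
rewrite integral_indic// setIT.
(* Now the integral of [f] plus [del] times the area of [D] is at most the integral of [g], hence at
   most that of [f], which is finite: a contradiction. *)
move: L_min cost_fin; rewrite !transport_cost_crossing//.
rewrite -/f -/g -[(\int[lebesgue2]_w g w)%E]/(\int[lebesgue2]_w g w)%E => gf foo.
move=> /le_trans/(_ gf); rewrite leNgt => /negP; apply.
rewrite lteDl//.
  apply: mule_gt0; first by rewrite lte_fin.
  by rewrite -[X in (_ < X)%E]/(lebesgue2 D) MD lte_fin mulr_gt0// subr_gt0.
by rewrite ge0_fin_numE// integral_ge0.
Qed.

End optimal_plan_unique.

(** Continuity of [L] from above along shrinking quadrants. With monotonicity, it spreads a strict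
    inequality from a point to a square. *)
Lemma jcdf_right_lt {R : realType} (L : probability (R * R)%type R) (s t c : R) :
  jcdf L s t < c -> exists2 e, 0 < e & jcdf L (s + e) (t + e) < c.
Proof.
move=> Lc; pose F n : set (R * R) :=
  `]-oo, s + n.+1%:R^-1] `*` `]-oo, t + n.+1%:R^-1].
have mF n : measurable (F n) by exact: measurableX.
have capF : \bigcap_n F n = `]-oo, s] `*` `]-oo, t].
  rewrite 2!(@itvNycEbigcap _ false); apply/seteqP; split => -[u v].
    by move=> Fuv; split => n _ /=; case: (Fuv n I).
  by case=> /= us vt n _; split; [exact: us|exact: vt].
have : L (F n) @[n --> \oo] --> L (\bigcap_n F n).
  apply: nonincreasing_cvg_mu => //.
  - by rewrite -ge0_fin_numE// fin_num_measure.
  - by rewrite capF; exact: measurableX.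
  - move=> m n mn; apply/subsetPset; apply: setSX; apply: subset_itvl;
    by rewrite bnd_simp lerD2l lef_pV2 ?posrE// ler_nat.
rewrite capF jcdfE => /fine_cvg/cvgr_lt/(_ _ Lc)/filter_ex[n Fn].
by exists n.+1%:R^-1; rewrite ?invr_gt0.
Qed.

Section jcdf_optimal.
Context {R : realType}.
Variable p : R.
Hypothesis p1 : 1 < p.
Variables (P Q : probability R R).
Hypothesis cost_fin : (transport_cost p (monotone_plan P Q) < +oo)%E.

Lemma jcdf_optimal (L : probability (R * R)%type R) s t : optimal_plans p P Q L ->
  jcdf L s t = Num.min (rcdf P s) (rcdf Q t).
Proof.
move=> [cL L_opt].
have L_min := L_opt _ (monotone_plan_coupling P Q).
have no_exc := optimal_no_excess p1 cL L_min cost_fin.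
have Lle := jcdf_le_min cL.
have minD a b a' b' : a <= a' -> b <= b' ->
    Num.min (rcdf P a) (rcdf Q b) <= Num.min (rcdf P a') (rcdf Q b').
  by move=> aa bb; apply: le_min2; exact: rcdf_nd.
(* On the square of side [e], the minimum is bounded below by its value at the lower corner and
   [jcdf] above by its value at the upper corner. At the swapped point [jcdf_le_min] rules out
   compensation. *)
have Lst a b : a != b -> Num.min (rcdf P a) (rcdf Q b) <= jcdf L a b.
  rewrite neq_lt leNgt => ab; apply/negP => /jcdf_right_lt[e e0].
  rewrite -subr_gt0; set del := (X in 0 < X) => del0.
  case/orP: ab => [ab|ba].
    apply: (no_exc a b e del) => // s' t' /andP[s0 s1] /andP[t0 t1] _.
    have := minD _ _ _ _ s0 t0; have := jcdf_nd L s1 t1; have := Lle t' s'.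
    by rewrite /del; lra.
  apply: (no_exc b a e del) => // s' t' /andP[s0 s1] /andP[t0 t1] _.
  have := minD _ _ _ _ t0 s0; have := jcdf_nd L t1 s1; have := Lle s' t'.
  by rewrite /del; lra.
(* [optimal_no_excess] only concerns pairs with distinct coordinates; the diagonal point [(s, s)] is
   reached from [(s, s + e)] by right continuity. *)
apply/eqP; rewrite eq_le Lle/=; have [<-|] := eqVneq s t; last exact: Lst.
rewrite leNgt; apply/negP => /jcdf_right_lt[e e0]; rewrite ltNge => /negP; apply.
have se : s <= s + e by rewrite lerDl ltW.
apply: (le_trans (minD _ _ _ _ (lexx s) se)).
apply: (@le_trans _ _ (jcdf L s (s + e))); last exact: jcdf_nd.
by apply: Lst; rewrite lt_eqF// ltrDl.
Qed.

End jcdf_optimal.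

(** * Finiteness of the transport cost *)

Lemma powR_norm_sub_le {R : realType} (p u v : R) : 0 < p ->
  `|u - v| `^ p <= 2 `^ p * (`|u| `^ p + `|v| `^ p).
Proof.
(* The difference is at most [2 * m], and [m ^ p] is one of the two summands on the right. *)
move=> p0; pose m := Num.max `|u| `|v|.
have m0 : 0 <= m by rewrite le_max normr_ge0.
apply: (@le_trans _ _ ((2 * m) `^ p)).
  apply: ge0_ler_powR; rewrite ?nnegrE ?mulr_ge0 ?(ltW p0)//.
  apply: (le_trans (ler_normB _ _)).
  have : `|u| <= m by rewrite le_max lexx.
  have : `|v| <= m by rewrite le_max lexx orbT.
  lra.
rewrite powRM// ler_wpM2l ?powR_ge0// /m.
by case: (leP `|u| `|v|) => _; rewrite ?lerDl ?lerDr powR_ge0.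
Qed.

Lemma transport_cost_fin {R : realType} (p : R) (P Q : probability R R)
    (L : probability (R * R)%type R) : 0 < p -> coupling P Q L ->
  (\int[P]_u (`|u| `^ p)%:E < +oo)%E -> (\int[Q]_u (`|u| `^ p)%:E < +oo)%E ->
  (transport_cost p L < +oo)%E.
Proof.
move=> p0 cL Pp Qp.
have mp : measurable_fun setT (fun u : R => `|u| `^ p).
  by apply: (@measurableT_comp _ _ _ _ _ _ (fun x => x `^ p)).
have mp1 : measurable_fun setT (fun z : R * R => `|z.1| `^ p).
  by apply: (measurableT_comp mp); exact: measurable_fst.
have mp2 : measurable_fun setT (fun z : R * R => `|z.2| `^ p).
  by apply: (measurableT_comp mp); exact: measurable_snd.
have mp12 : measurable_fun setT (fun z : R * R => `|z.1 - z.2| `^ p).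
  apply: (measurableT_comp mp); apply: measurable_funB; [exact: measurable_fst|exact: measurable_snd].
have L1 : (\int[L]_z (`|z.1| `^ p)%:E = \int[P]_u (`|u| `^ p)%:E)%E.
  rewrite -(@ge0_integral_pushforward _ _ _ _ R fst measurable_fst L setT (fun u => (`|u| `^ p)%:E))//.
    by apply: eq_measure_integral => A mA _; case: cL => _ /(_ A mA).
  exact/measurable_EFinP.
have L2 : (\int[L]_z (`|z.2| `^ p)%:E = \int[Q]_u (`|u| `^ p)%:E)%E.
  rewrite -(@ge0_integral_pushforward _ _ _ _ R snd measurable_snd L setT (fun u => (`|u| `^ p)%:E))//.
    by apply: eq_measure_integral => A mA _; case: cL => _ _ /(_ A mA).
  exact/measurable_EFinP.
apply: (@le_lt_trans _ _ (\int[L]_z ((2 `^ p)%:E * ((`|z.1| `^ p)%:E + (`|z.2| `^ p)%:E)))%E).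
  apply: ge0_le_integral => //.
  - exact/measurable_EFinP.
  -  by apply: measurable_funeM; apply: emeasurable_funD; exact/measurable_EFinP.
  - by move=> z _; rewrite -EFinD -EFinM lee_fin powR_norm_sub_le.
rewrite ge0_integralZl_EFin//; last 2 first.
- by move=> z _; rewrite adde_ge0 ?lee_fin ?powR_ge0.
- by apply: emeasurable_funD; exact/measurable_EFinP.
rewrite ge0_integralD//; last 2 first.
- exact/measurable_EFinP.
- exact/measurable_EFinP.
by rewrite L1 L2 lte_mul_pinfty ?lee_fin ?powR_ge0// lte_add_pinfty.
Qed.

(** * Countable sums and discrete measures *)

(** Turns a sum over [S] into a series; empty pieces account for the indices missed by the injection
    into [nat]. *)
Lemma countable_singletons {T : Type} (S : set T) : countable S ->
  exists F : nat -> set T, [/\ S = \bigcup_n F n, trivIset setT F &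
    forall n, F n = set0 \/ exists x, F n = [set x]].
Proof.
move=> /countable_injP[f f_inj].
exists (fun n => S `&` f @^-1` [set n]); split.
- by apply/seteqP; split => x; [move=> Sx; exists (f x)|move=> [n _ []]].
- by move=> m n _ _ [x [[_ /= <-] [_ /= <-]]].
- move=> n; have [->|/set0P[x [Sx fx]]] := eqVneq (S `&` f @^-1` [set n]) set0.
    by left.
  right; exists x; apply/seteqP; split => [y [Sy fy]|y ->//].
  by apply: f_inj; rewrite ?inE//; exact: (etrans fy (esym fx)).
Qed.

Section esum_countable.
Context {R : realType}.
Local Open Scope ereal_scope.

Lemma esum_bigcup_nat {T : choiceType} (F : nat -> set T) (a : T -> \bar R) :
  trivIset setT F -> (forall x, 0 <= a x) ->
  \esum_(x in \bigcup_n F n) a x = \sum_(n <oo) \esum_(x in F n) a x.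
Proof.
move=> tF a0; rewrite esum_bigcupT// -nneseries_esumT// => n.
by apply: esum_ge0 => x _.
Qed.

Lemma countable_esumZl {T : choiceType} (S : set T) (k : R) (a : T -> \bar R) :
  countable S -> (0 <= k)%R -> (forall x, 0 <= a x) ->
  \esum_(x in S) (k%:E * a x) = k%:E * \esum_(x in S) a x.
Proof.
move=> /countable_singletons[F [-> tF F1]] k0 a0.
have ka0 x : 0 <= k%:E * a x by rewrite mule_ge0.
rewrite !esum_bigcup_nat// -nneseriesZl; last first.
  by move=> n _; apply: esum_ge0 => x _.
apply: eq_eseriesr => n _; have [->|[x ->]] := F1 n.
  by rewrite !esum_set0 mule0.
by rewrite !esum_set1.
Qed.

Lemma esum_support {T : choiceType} (A S : set T) (a : T -> \bar R) :
  (forall x, A x -> ~ S x -> a x = 0) ->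
  \esum_(x in A) a x = \esum_(x in A `&` S) a x.
Proof.
move=> a0; rewrite esum_mkcondr; apply: eq_esum => x Ax.
by case: ifPn => //; rewrite notin_setE => /(a0 _ Ax).
Qed.

Lemma esum_fibers {T U : choiceType} (S : set T) (h : T -> U) (a : T -> \bar R) :
  (forall x, 0 <= a x) ->
  \esum_(x in S) a x =
  \esum_(v in h @` S) \esum_(x in S `&` h @^-1` [set v]) a x.
Proof.
move=> a0; rewrite (esum_esum (a := fun=> a))//.
rewrite (reindex_esum S _ (fun x => (h x, x)))//; split.
- by move=> x Sx /=; split => //; exists x.
- by move=> x y _ _ [].
- by move=> [v x] [/= _ [Sx <-]]; exists x.
Qed.

Context {d} {T : measurableType d}.

(** Termwise integration of a nonnegative series, after enumerating [S]. *)
Lemma countable_esum_integral {U : choiceType} (mu : {measure set T -> \bar R})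
    (D : set T) (S : set U) (f : U -> T -> \bar R) : measurable D -> countable S ->
  (forall x, S x -> measurable_fun D (f x)) -> (forall x t, 0 <= f x t) ->
  \esum_(x in S) \int[mu]_(t in D) f x t = \int[mu]_(t in D) \esum_(x in S) f x t.
Proof.
move=> mD /countable_singletons[F [SE tF F1]] mf f0.
rewrite SE esum_bigcup_nat//; last by move=> x; exact: integral_ge0.
under [RHS]eq_integral do rewrite esum_bigcup_nat//.
rewrite integral_nneseries//.
- apply: eq_eseriesr => n _; have [->|[x ->]] := F1 n.
    rewrite esum_set0; under eq_integral do rewrite esum_set0.
    by rewrite integral0.
  rewrite esum_set1; last exact: integral_ge0.
  by apply: eq_integral => t _; rewrite esum_set1.
- move=> n; have [->|[x Fx]] := F1 n.
    by under eq_fun do rewrite esum_set0; exact: measurable_cst.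
  rewrite Fx; under eq_fun do rewrite esum_set1//.
  by apply: mf; rewrite SE; exists n => //; rewrite Fx.
- by move=> n t _; apply: esum_ge0.
Qed.

Hypothesis mT : forall x : T, measurable [set x].
Variable mu : {measure set T -> \bar R}.

Lemma measure_countable (S : set T) : countable S ->
  mu S = \esum_(x in S) mu [set x].
Proof.
move=> cS; have [F [SE tF F1]] := countable_singletons cS.
have mF n : measurable (F n) by have [->|[x ->]] := F1 n.
rewrite SE esum_bigcup_nat// measure_semi_bigcup//; last exact: bigcup_measurable.
apply: eq_eseriesr => n _; have [->|[x ->]] := F1 n; first by rewrite esum_set0 measure0.
by rewrite esum_set1.
Qed.

End esum_countable.

Section discrete.
Context {R : realType} {d} {T : measurableType d}.
Variable mu : probability T R.
Hypothesis mT : forall x : T, measurable [set x].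
Hypothesis mu_discrete : is_discrete mu.
Local Open Scope ereal_scope.

Definition atoms : set T := [set x | mu [set x] != 0].

(** Any countable set [S] of full measure contains the atoms, and its remaining points form a
    countable union of null singletons. *)
Lemma atoms_discrete : countable atoms /\ mu (~` atoms) = 0.
Proof.
have [S cS muS] := mu_discrete.
have mS B : B `<=` S -> measurable B.
  by move=> BS; apply: countable_measurable => //; exact: sub_countable (subset_card_le BS) cS.
have aS : atoms `<=` S.
  move=> x; apply: contra_neqP => Sx; apply/eqP; rewrite eq_le measure_ge0 andbT -muS.
  by apply: le_measure; rewrite ?inE//; [exact: measurableC (mS S _)|move=> y ->].
split; first exact: sub_countable (subset_card_le aS) cS.
have -> : ~` atoms = (S `\` atoms) `|` ~` S.
  apply/seteqP; split => x; last by move=> [[]//|Sx /aS].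
  by move=> ax; have [Sx|Sx] := pselect (S x); [left|right].
rewrite measureU.
- rewrite -[RHS]adde0; congr (_ + _); last exact: muS.
  transitivity (mu (S `\` atoms)) => //.
  rewrite measure_countable//; last first.
    by apply: sub_countable cS; apply: subset_card_le => x [].
  by apply: esum1 => x [_]; rewrite /atoms/= => /negP; rewrite negbK => /eqP.
- by apply: mS => x [].
- exact/measurableC/mS.
- by apply/seteqP; split => // x [[]].
Qed.

Lemma measure_discrete (A : set T) : measurable A ->
  mu A = \esum_(x in A) mu [set x].
Proof.
move=> mA; have [cS muS] := atoms_discrete.
have mS : measurable atoms by exact: countable_measurable.
rewrite (esum_support (S := atoms)); last first.
  by move=> x _; rewrite /atoms/= => /negP; rewrite negbK => /eqP.
rewrite -measure_countable//; last first.
  by apply: sub_countable cS; apply: subset_card_le => x [].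
rewrite -[in LHS](setIT A) -(setUv atoms) setIUr measureU.
- rewrite [X in _ + X](_ : _ = 0) ?adde0//.
  apply/eqP; rewrite eq_le measure_ge0 andbT -muS.
  by apply: le_measure; rewrite ?inE//; [apply: measurableI => //; exact: measurableC|exact: measurableC].
- exact: measurableI.
- by apply: measurableI => //; exact: measurableC.
- by apply/seteqP; split => // x [[_ +] [_]].
Qed.

End discrete.

(** * Slices *)

Section coupling_atoms.
Context {R : realType} (P Q : probability R R) (L : probability (R * R)%type R).
Hypothesis cL : coupling P Q L.
Local Open Scope ereal_scope.

Lemma measurable_set1_pair (z : R * R) : measurable [set z].
Proof.
case: z => u v; rewrite (_ : [set (u, v)] = [set u] `*` [set v]).
  by apply: measurableX; exact: measurable_set1.
by apply/seteqP; split => -[x y] /=; [case=> -> ->|case=> -> ->].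
Qed.

(** The part of the line over [u] outside [V] is null because its second projection is, so countable
    additivity applies to what remains. *)
Lemma coupling_row_sum (V : set R) u : countable V -> Q (~` V) = 0 ->
  \esum_(v in V) L [set (u, v)] = P [set u].
Proof.
move=> cV QV; have mV : measurable V by apply: countable_measurable => // x; exact: measurable_set1.
have mu1 : measurable [set u] by exact: measurable_set1.
rewrite -(coupling_fst cL)//.
have -> : [set u] `*` [set: R] = ([set u] `*` V) `|` ([set u] `*` ~` V).
  apply/seteqP; split => -[x y] /=; last by case=> -[].
  by case=> xu _; have [Vy|Vy] := pselect (V y); [left|right].
rewrite measureU; [|exact: measurableX|by apply: measurableX => //; exact: measurableC|]; last first.
  by apply/seteqP; split => // -[x y] [[_ +] [_ +]].
rewrite [X in _ = _ + X](_ : _ = 0) ?adde0; last first.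
  apply/eqP; rewrite eq_le measure_ge0 andbT -QV -(coupling_snd cL); last exact: measurableC.
  apply: le_measure; rewrite ?inE; [by apply: measurableX => //; exact: measurableC..|].
  exact: setSX.
have := @measure_countable R _ _ measurable_set1_pair L ([set u] `*` V).
rewrite (_ : [set u] `*` V = (pair u) @` V); last first.
  apply/seteqP; split => -[x y] /=; first by case=> -> Vy; exists y.
  by case=> v Vv [<- <-].
rewrite (esum_image _ (pair u)); last by move=> x y _ _ [].
move=> H; apply/esym/H; apply: sub_countable cV; exact: card_image_le.
Qed.

Lemma coupling_column_sum (U : set R) v : countable U -> P (~` U) = 0 ->
  \esum_(u in U) L [set (u, v)] = Q [set v].
Proof.
move=> cU PU; have mU : measurable U by apply: countable_measurable => // x; exact: measurable_set1.
have mu1 : measurable [set v] by exact: measurable_set1.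
rewrite -(coupling_snd cL)//.
have -> : [set: R] `*` [set v] = (U `*` [set v]) `|` (~` U `*` [set v]).
  apply/seteqP; split => -[x y] /=; last by case=> -[].
  by case=> _ yv; have [Ux|Ux] := pselect (U x); [left|right].
rewrite measureU; [|exact: measurableX|by apply: measurableX => //; exact: measurableC|]; last first.
  by apply/seteqP; split => // -[x y] [[+ _] [+ _]].
rewrite [X in _ = _ + X](_ : _ = 0) ?adde0; last first.
  apply/eqP; rewrite eq_le measure_ge0 andbT -PU -(coupling_fst cL); last exact: measurableC.
  apply: le_measure; rewrite ?inE; [by apply: measurableX => //; exact: measurableC..|].
  exact: setSX.
have := @measure_countable R _ _ measurable_set1_pair L (U `*` [set v]).
rewrite (_ : U `*` [set v] = (pair^~ v) @` U); last first.
  apply/seteqP; split => -[x y] /=; first by case=> Ux ->; exists x.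
  by case=> u Uu [<- <-].
rewrite (esum_image _ (pair^~ v)); last by move=> x y _ _ [].
move=> H; apply/esym/H; apply: sub_countable cU; exact: card_image_le.
Qed.

End coupling_atoms.

(** Inclusion-exclusion: the expression is the mass of a half-open rectangle with upper corner
    [(u, v)], and these rectangles shrink to that point. *)
Lemma cvg_coupling_atom {R : realType} (L : probability (R * R)%type R) (u v : R) :
  ((jcdf L u v - jcdf L (u - n.+1%:R^-1) v) -
   (jcdf L u (v - n.+1%:R^-1) - jcdf L (u - n.+1%:R^-1) (v - n.+1%:R^-1)))%:E
   @[n --> \oo] --> L [set (u, v)].
Proof.
pose F n : set (R * R) := `]u - n.+1%:R^-1, u] `*` `]v - n.+1%:R^-1, v].
have mF n : measurable (F n) by exact: measurableX.
have finL (A : set (R * R)) : measurable A -> (L A < +oo)%E.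
  by move=> mA; rewrite -ge0_fin_numE// fin_num_measure.
have strip (a b : R) : a <= u -> L (`]a, u] `*` `]-oo, b]) = (jcdf L u b - jcdf L a b)%:E.
  move=> au; have -> : `]a, u] `*` `]-oo, b] =
      (`]-oo, u] `*` `]-oo, b]) `\` (`]-oo, a] `*` `]-oo, b]) :> set (R * R).
    apply/seteqP; split => -[x y] /=; rewrite !in_itv/=.
      by move=> [/andP[ax ->] ->]; split => // -[]; rewrite leNgt ax.
    move=> [[-> yb] xa]; rewrite andbT ltNge; split=> //.
    by apply/negP => xa'; apply: xa; split.
  rewrite measureD; [|exact: measurableX..|by apply: finL; exact: measurableX].
  rewrite setIidr; last by apply: setSX => //; apply: subset_itvl; rewrite bnd_simp.
  by rewrite EFinB; congr (_ - _)%E; exact: jcdfE.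
have -> : (fun n => ((jcdf L u v - jcdf L (u - n.+1%:R^-1) v) -
   (jcdf L u (v - n.+1%:R^-1) - jcdf L (u - n.+1%:R^-1) (v - n.+1%:R^-1)))%:E) = L \o F.
  apply/funext => n /=; set e := n.+1%:R^-1.
  have e0 : 0 <= e by rewrite invr_ge0.
  have ue : u - e <= u by rewrite gerBl.
  have -> : F n = (`]u - e, u] `*` `]-oo, v]) `\` (`]u - e, u] `*` `]-oo, v - e]).
    apply/seteqP; split => -[x y].
      by move=> [xu /=]; rewrite !in_itv/= => /andP[vy ->]; split => // -[_] /=; rewrite leNgt vy.
    move=> [[xu /=]]; rewrite !in_itv/= => yv nyv; split => //=; rewrite in_itv/= yv andbT ltNge.
    by apply/negP => yv'; apply: nyv; split => //=; rewrite in_itv.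
  rewrite measureD; [|exact: measurableX..|by apply: finL; exact: measurableX].
  rewrite setIidr; last by apply: setSX => //; apply: subset_itvl; rewrite bnd_simp gerBl.
  by rewrite EFinB; congr (_ - _)%E; exact/esym/strip.
have capF : \bigcap_n F n = [set (u, v)].
  have lim_le (a x : R) : (forall n, a - n.+1%:R^-1 < x) -> a <= x.
    move=> ax; rewrite leNgt; apply/negP => xa.
    pose n := Num.truncn (a - x)^-1.
    have : n.+1%:R^-1 < a - x.
      rewrite -[a - x]invrK ltf_pV2 ?posrE ?invr_gt0 ?subr_gt0//.
      exact: truncnS_gt.
    by rewrite ltrBrDl -ltrBrDr => /(lt_trans (ax n)); rewrite ltxx.
  apply/seteqP; split => -[x y].
    move=> Fxy.
    have Fx n : u - n.+1%:R^-1 < x <= u by have [/= + _] := Fxy n I; rewrite in_itv.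
    have Fy n : v - n.+1%:R^-1 < y <= v by have [/= _] := Fxy n I; rewrite in_itv.
    have /andP[_ xu] := Fx 0%N; have /andP[_ yv] := Fy 0%N.
    congr (_, _); apply/eqP; rewrite eq_le ?xu ?yv/=; apply: lim_le => n.
      by case/andP: (Fx n).
    by case/andP: (Fy n).
  by case=> -> -> n _; split; rewrite /= in_itv/= lexx andbT ltrBlDr ltrDl.
rewrite -capF; apply: nonincreasing_cvg_mu => //.
- exact: finL.
- by rewrite capF; exact: measurable_set1_pair.
- move=> m n mn; apply/subsetPset; apply: setSX; apply: subset_itvr;
  by rewrite bnd_simp lerD2l lerN2 lef_pV2 ?posrE// ler_nat.
Qed.

(** * Measurability in the direction [theta] *)

Section euclidean_measurability.
Context {R : realType} {d : nat}.
Local Notation E := (d.-tuple R).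

Lemma measurable_set1_tuple (x : E) : measurable [set x].
Proof.
(* The singleton is the zero set of the l1 distance to [x]. *)
pose f (y : E) : R := \sum_(i < d) `|tnth y i - tnth x i|.
have mf : measurable_fun setT f.
  apply: measurable_sum => i; apply: measurableT_comp => //.
  by apply: measurable_funB => //; exact: measurable_tnth.
rewrite (_ : [set x] = setT `&` f @^-1` [set 0]); first exact: mf.
rewrite setTI; apply/seteqP; split => y /=; rewrite /f.
  by move=> ->; rewrite big1// => i _; rewrite subrr normr0.
move=> /psumr_eq0P y0; apply: eq_from_tnth => i.
by apply/eqP; rewrite -subr_eq0 -normr_eq0 y0.
Qed.

Lemma measurable_dot_pair : measurable_fun setT (fun z : E * E => dot z.1 z.2).
Proof.
apply: measurable_sum => i; apply: measurable_funM.
  by apply: (measurableT_comp (measurable_tnth i)); exact: measurable_fst.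
by apply: (measurableT_comp (measurable_tnth i)); exact: measurable_snd.
Qed.

Lemma measurable_dotl (x : E) : measurable_fun setT (fun theta : E => dot theta x).
Proof.
by apply: measurable_sum => i; apply: measurable_funM => //; exact: measurable_tnth.
Qed.

Lemma dot_ge0 (x : E) : 0 <= dot x x.
Proof. by apply: sumr_ge0 => i _; rewrite -expr2 sqr_ge0. Qed.

Lemma measurable_enorm : measurable_fun setT (@enorm R d).
Proof.
have -> : @enorm R d = fun x => dot x x `^ 2^-1.
  by apply/funext => x; rewrite powR12_sqrt// dot_ge0.
apply: (measurableT_comp (measurable_powR 2^-1)).
by apply: measurable_sum => i; apply: measurable_funM => //; exact: measurable_tnth.
Qed.

Lemma measurable_sphere : measurable (@sphere R d).
Proof.
rewrite (_ : sphere = setT `&` (@enorm R d) @^-1` [set 1]); last by rewrite setTI.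
by apply: measurable_enorm => //; exact: measurable_set1.
Qed.

(** The mass of a section of a measurable set depends measurably on the section point; slice
    distribution functions and fiber masses are both of this form. *)
Lemma measurable_section_mass (mu : probability E R) (b : E * E -> bool) :
  measurable_fun setT b ->
  measurable_fun setT (fun theta => fine (mu [set x | b (theta, x)])).
Proof.
move=> mb; pose B : set (E * E) := setT `&` b @^-1` [set true].
have mB : measurable B by exact: mb.
apply: (measurableT_comp (@fine_measurable R setT measurableT)).
have -> : (fun theta => mu [set x | b (theta, x)]) = mu \o xsection B.
  apply/funext => theta /=; congr (mu _); apply/seteqP; split => x;
  by rewrite /xsection /= in_setE /B setTI.
exact: measurable_fun_xsection.
Qed.

(** The evaluation point moves with [theta]; the shift [c] provides the corners of the rectangles in
    [cvg_coupling_atom]. *)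
Lemma measurable_slice_cdf (mu : probability E R) (x : E) (c : R) :
  measurable_fun setT (fun theta => rcdf (distribution mu (dot theta)) (dot theta x - c)).
Proof.
have := @measurable_section_mass mu (fun z => dot z.1 z.2 <= dot z.1 x - c).
have H : measurable_fun setT (fun z : E * E => dot z.1 z.2 <= dot z.1 x - c).
  apply: measurable_fun_ler; first exact: measurable_dot_pair.
  apply: measurable_funB => //.
  by apply: (measurableT_comp (measurable_dotl x)); exact: measurable_fst.
move=> /(_ H); congr (measurable_fun _ _); apply/funext => theta.
Qed.

Lemma dot_le_enorm (theta x : E) : sphere theta -> `|dot theta x| <= enorm x.
Proof.
rewrite /sphere/= => theta1.
have th1 : dot theta theta = 1.
  have := theta1; rewrite /enorm => /(congr1 (fun y => y ^+ 2)); rewrite sqr_sqrtr ?expr1n ?dot_ge0//.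
apply: (@le_trans _ _ (Num.sqrt (dot theta x ^+ 2))); first by rewrite sqrtr_sqr.
apply: ler_wsqrtr.
(* Cauchy-Schwarz, by expanding the squared norm of the component of [x] orthogonal to [theta]. *)
have : 0 <= \sum_(i < d) (tnth x i - dot theta x * tnth theta i) ^+ 2.
  by apply: sumr_ge0 => i _; rewrite sqr_ge0.
have -> : \sum_(i < d) (tnth x i - dot theta x * tnth theta i) ^+ 2 =
   dot x x - dot theta x * dot theta x *+ 2 + dot theta x ^+ 2 * dot theta theta.
  rewrite -mulrnAr {2}/dot -[in X in _ * X]sumrMnl !mulr_sumr -sumrN -!big_split/=.
  by apply: eq_bigr => i _; ring.
by rewrite th1; lra.
Qed.

End euclidean_measurability.

Section slices.
Context {R : realType} {d : nat}.
Local Notation E := (d.-tuple R).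

Lemma slice_moment (p : R) (mu : probability E R) (theta : E) : 0 <= p ->
  sphere theta -> finite_moment p mu ->
  (\int[distribution mu (dot theta)]_u (`|u| `^ p)%:E < +oo)%E.
Proof.
move=> p0 th1; rewrite /finite_moment; apply: le_lt_trans.
have mp : measurable_fun setT (fun u : R => (`|u| `^ p)%:E).
  apply/measurable_EFinP.
  by apply: (@measurableT_comp _ _ _ _ _ _ (fun x => x `^ p)).
rewrite (ge0_integral_distribution (dot theta) mp)//.
apply: ge0_le_integral => //.
- by move=> x _; rewrite /= lee_fin powR_ge0.
- exact: (measurableT_comp mp (measurable_dot theta)).
- apply/measurable_EFinP; apply: (measurableT_comp (measurable_powR p)).
  exact: measurable_enorm.
- move=> x _; rewrite lee_fin; apply: ge0_ler_powR => //; rewrite ?nnegrE ?sqrtr_ge0//.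
  exact: dot_le_enorm.
Qed.

Lemma measurable_fiber (theta : E) (v : R) : measurable (dot theta @^-1` [set v]).
Proof.
by rewrite -[X in measurable X]setTI; apply: measurable_dot.
Qed.

Variable nu : probability E R.
Hypothesis nu_discrete : is_discrete nu.

Let matom (x : E) : measurable [set x] := measurable_set1_tuple x.

Lemma massE x : nu [set x] = (mass nu x)%:E.
Proof. by rewrite fineK// fin_num_measure. Qed.

Lemma fiber_massE (theta x : E) :
  (fiber_mass nu theta x)%:E = nu (dot theta @^-1` [set dot theta x]).
Proof.
rewrite /fiber_mass -(measure_discrete matom nu_discrete); last exact: measurable_fiber.
by rewrite fineK// fin_num_measure//; exact: measurable_fiber.
Qed.

Lemma mass_le_fiber_mass (theta x : E) : mass nu x <= fiber_mass nu theta x.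
Proof.
rewrite -lee_fin fiber_massE -massE; apply: le_measure; rewrite ?inE; [exact: matom|exact: measurable_fiber|].
by move=> y ->.
Qed.

Lemma mass_ge0 x : 0 <= mass nu x. Proof. exact: fine_ge0. Qed.

Lemma atomsE x : atoms nu x = (mass nu x != 0) :> Prop.
Proof. by rewrite /atoms/= massE eqe. Qed.

Lemma fiber_mass_gt0 (theta x : E) : mass nu x != 0 -> 0 < fiber_mass nu theta x.
Proof.
move=> x0; apply: (lt_le_trans _ (mass_le_fiber_mass theta x)).
by rewrite lt_neqAle eq_sym x0 mass_ge0.
Qed.

(** Atoms are grouped by fibers of [dot theta]: on each fiber [m] and [fiber_mass] are constant, and
    the masses add up to [fiber_mass], which cancels. *)
Lemma esum_slice (theta : E) (c : R) (m : R -> R) : 0 <= c -> (forall v, 0 <= m v) ->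
  (\esum_(y in atoms nu)
     (c * (mass nu y / fiber_mass nu theta y) * m (dot theta y))%:E =
   c%:E * \esum_(v in dot theta @` atoms nu) (m v)%:E)%E.
Proof.
move=> c0 m0; have [cA _] := atoms_discrete matom nu_discrete.
have fib0 y : 0 <= fiber_mass nu theta y := le_trans (mass_ge0 y) (mass_le_fiber_mass theta y).
rewrite (esum_fibers _ (dot theta)); last first.
  by move=> y; rewrite lee_fin !mulr_ge0// ?invr_ge0// mass_ge0.
rewrite -countable_esumZl//; last first.
  exact: (sub_countable (card_image_le _ _) cA).
apply: eq_esum => _ [y0 Ay0 <-].
have y0n : mass nu y0 != 0 by move: Ay0; rewrite atomsE.
set Q := fiber_mass nu theta y0.
have Q0 : 0 < Q by exact: fiber_mass_gt0.
transitivity (\esum_(y in atoms nu `&` dot theta @^-1` [set dot theta y0])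
    ((c / Q * m (dot theta y0))%:E * nu [set y]))%E.
  apply: eq_esum => y [Ay /= yy0]; rewrite massE -EFinM; congr (_%:E).
  have -> : fiber_mass nu theta y = Q by rewrite /fiber_mass yy0.
  by rewrite yy0; ring.
rewrite countable_esumZl; last 3 first.
- by apply: sub_countable cA; apply: subset_card_le => y [].
- by rewrite mulr_ge0// divr_ge0// ltW.
- by [].
(* Points of the fiber that are not atoms add nothing, so the sum is the mass of the whole fiber. *)
rewrite setIC -esum_support; last first.
  by move=> y _; rewrite /atoms/= => /negP; rewrite negbK => /eqP.
rewrite -(measure_discrete matom nu_discrete); last exact: measurable_fiber.
rewrite -fiber_massE -/Q -!EFinM; congr (_%:E).
by rewrite mulrAC divfK// gt_eqF.
Qed.

(** Lets the projected atoms serve as the countable set of full measure in the row and column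
    sums. *)
Lemma slice_atoms_null (theta : E) :
  distribution nu (dot theta) (~` (dot theta @` atoms nu)) = 0%E.
Proof.
have [cA nA] := atoms_discrete matom nu_discrete.
apply/eqP; rewrite -[distribution _ _ _]/(nu (dot theta @^-1` _)).
rewrite eq_le measure_ge0 andbT -nA.
have cV : countable (dot theta @` atoms nu) := sub_countable (card_image_le _ _) cA.
have mV : measurable (dot theta @` atoms nu).
  by apply: countable_measurable => // v; exact: measurable_set1.
apply: le_measure; rewrite ?inE.
- rewrite -[X in measurable X]setTI; apply: measurable_dot => //; exact: measurableC.
- by apply: measurableC; exact: countable_measurable.
- by move=> y /= ny Ay; apply: ny; exists y.
Qed.

Lemma countable_slice_atoms (theta : E) : countable (dot theta @` atoms nu).
Proof.
have [cA _] := atoms_discrete matom nu_discrete.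
exact: (sub_countable (card_image_le _ _) cA).
Qed.

End slices.

(** * Marginals of the lifted plan for a fixed direction *)

Section lifted_plan.
Context {R : realType} {d : nat}.
Local Notation E := (d.-tuple R).
Variable p : R.
Hypothesis p1 : 1 < p.
Variables mu1 mu2 : probability E R.
Hypotheses (mu1_discrete : is_discrete mu1) (mu2_discrete : is_discrete mu2).
Hypotheses (mu1_moment : finite_moment p mu1) (mu2_moment : finite_moment p mu2).

Lemma sliced_cost_fin (theta : E) : sphere theta ->
  (transport_cost p (monotone_plan (distribution mu1 (dot theta))
     (distribution mu2 (dot theta))) < +oo)%E.
Proof.
move=> th1; have p0 : 0 < p := lt_trans ltr01 p1.
apply: (transport_cost_fin p0 (monotone_plan_coupling _ _)); apply: slice_moment => //; exact: ltW.
Qed.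

(** The monotone plan witnesses that the set is nonempty, so [get] returns one of its elements. *)
Lemma sliced_optimal_planP (theta : E) :
  optimal_plans p (distribution mu1 (dot theta)) (distribution mu2 (dot theta))
    (sliced_optimal_plan p mu1 mu2 theta).
Proof.
apply: getPex; exists (monotone_plan (distribution mu1 (dot theta))
  (distribution mu2 (dot theta))).
exact: monotone_plan_optimal.
Qed.

Let slice theta := sliced_optimal_plan p mu1 mu2 theta.

Let sliceE theta u v : slice theta [set (u, v)] = (fine (slice theta [set (u, v)]))%:E.
Proof. by rewrite fineK// fin_num_measure//; exact: measurable_set1_pair. Qed.

(** [esum_slice] removes the weights of [mu2]; the remaining row sum of the slice plan is the fiber
    mass of [x], which cancels the other denominator. *)
Lemma lifted_row_sum (theta x : E) : mass mu1 x != 0 ->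
  (\esum_(y in atoms mu2) lifted_mass p mu1 mu2 theta (x, y) = mu1 [set x])%E.
Proof.
move=> x0; have P0 : 0 < fiber_mass mu1 theta x by exact: fiber_mass_gt0.
have [cL _] := sliced_optimal_planP theta.
transitivity (\esum_(y in atoms mu2) (mass mu1 x / fiber_mass mu1 theta x *
  (mass mu2 y / fiber_mass mu2 theta y) *
  fine (slice theta [set (dot theta x, dot theta y)]))%:E)%E.
  apply: eq_esum => y; rewrite atomsE => y0.
  rewrite /lifted_mass/= x0 y0/= -/(slice theta) sliceE -EFinM; congr (_%:E).
  by rewrite invfM; ring.
rewrite (esum_slice mu2_discrete theta (m := fun v => fine (slice theta [set (dot theta x, v)])));
  [|by rewrite divr_ge0 ?mass_ge0// ltW|by move=> v; exact: fine_ge0].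
under eq_esum do rewrite -sliceE.
rewrite (coupling_row_sum cL); [|exact: countable_slice_atoms|exact: slice_atoms_null].
transitivity ((mass mu1 x / fiber_mass mu1 theta x)%:E *
  mu1 (dot theta @^-1` [set dot theta x]))%E; first by [].
rewrite -fiber_massE// -EFinM divfK ?massE//.
by rewrite gt_eqF.
Qed.

Lemma lifted_column_sum (theta y : E) : mass mu2 y != 0 ->
  (\esum_(x in atoms mu1) lifted_mass p mu1 mu2 theta (x, y) = mu2 [set y])%E.
Proof.
move=> y0; have Q0 : 0 < fiber_mass mu2 theta y by exact: fiber_mass_gt0.
have [cL _] := sliced_optimal_planP theta.
transitivity (\esum_(x in atoms mu1) (mass mu2 y / fiber_mass mu2 theta y *
  (mass mu1 x / fiber_mass mu1 theta x) *
  fine (slice theta [set (dot theta x, dot theta y)]))%:E)%E.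
  apply: eq_esum => x; rewrite atomsE => x0.
  rewrite /lifted_mass/= x0 y0/= -/(slice theta) sliceE -EFinM; congr (_%:E).
  by rewrite invfM; ring.
rewrite (esum_slice mu1_discrete theta (m := fun u => fine (slice theta [set (u, dot theta y)])));
  [|by rewrite divr_ge0 ?mass_ge0// ltW|by move=> v; exact: fine_ge0].
under eq_esum do rewrite -sliceE.
rewrite (coupling_column_sum cL); [|exact: countable_slice_atoms|exact: slice_atoms_null].
transitivity ((mass mu2 y / fiber_mass mu2 theta y)%:E *
  mu2 (dot theta @^-1` [set dot theta y]))%E; first by [].
rewrite -fiber_massE// -EFinM divfK ?massE//.
by rewrite gt_eqF.
Qed.

End lifted_plan.

(** * Averaging over the sphere and the marginals of the expected plan *)

Section expected_plan.
Context {R : realType} {d : nat}.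
Local Notation E := (d.-tuple R).
Variable p : R.
Hypothesis p1 : 1 < p.
Variables mu1 mu2 : probability E R.
Hypotheses (mu1_discrete : is_discrete mu1) (mu2_discrete : is_discrete mu2).
Hypotheses (mu1_moment : finite_moment p mu1) (mu2_moment : finite_moment p mu2).

Lemma measurable_fiber_mass (nu : probability E R) (x : E) : is_discrete nu ->
  measurable_fun setT (fun theta => fiber_mass nu theta x).
Proof.
move=> dnu; have := @measurable_section_mass _ _ nu (fun z => dot z.1 z.2 == dot z.1 x).
have H : measurable_fun setT (fun z : E * E => dot z.1 z.2 == dot z.1 x).
  apply: measurable_fun_eqr; first exact: measurable_dot_pair.
  by apply: (measurableT_comp (measurable_dotl x)); exact: measurable_fst.
move=> /(_ H); congr (measurable_fun _ _); apply/funext => theta.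
rewrite -[RHS]/(fine (fiber_mass nu theta x)%:E) fiber_massE//; congr (fine (nu _)).
by apply/seteqP; split => y /= /eqP.
Qed.

(** The plan is chosen by [get] separately for each [theta], so regularity in [theta] comes from
    uniqueness: its joint distribution function is a minimum of measurable slice functions, and its
    atoms are limits of these. *)
Lemma measurable_sliced_optimal_atom (x y : E) :
  measurable_fun sphere
    (fun theta => sliced_optimal_plan p mu1 mu2 theta [set (dot theta x, dot theta y)]).
Proof.
(* For [theta] on the sphere, where the slice cost is finite, this is [jcdf] of the optimal plan at
   the projected point shifted by [-a] and [-b]. *)
pose H a b (theta : E) := Num.min
  (rcdf (distribution mu1 (dot theta)) (dot theta x - a))
  (rcdf (distribution mu2 (dot theta)) (dot theta y - b)).
have mH a b : measurable_fun sphere (H a b).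
  by apply: measurable_minr; apply: measurable_funTS; exact: measurable_slice_cdf.
pose e n : R := n.+1%:R^-1.
apply: (emeasurable_fun_cvg (fun n theta =>
  ((H 0 0 theta - H (e n) 0 theta) - (H 0 (e n) theta - H (e n) (e n) theta))%:E)).
  move=> n; apply/measurable_EFinP.
  by apply: measurable_funB; apply: measurable_funB; exact: mH.
move=> theta th1.
have := @cvg_coupling_atom R (sliced_optimal_plan p mu1 mu2 theta) (dot theta x) (dot theta y).
apply: cvg_trans; apply: near_eq_cvg; near=> n.
by rewrite !(jcdf_optimal p1 (sliced_cost_fin p1 mu1_moment mu2_moment th1)
  _ _ (sliced_optimal_planP p1 mu1 mu2 theta)) /H !subr0.
Unshelve. all: by end_near. Qed.

Lemma measurable_lifted_mass (z : E * E) :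
  measurable_fun sphere (fun theta => lifted_mass p mu1 mu2 theta z).
Proof.
rewrite /lifted_mass; case: (boolP (_ && _)) => [/andP[x0 y0]|_]; last first.
  exact: measurable_cst.
apply: emeasurable_funM; last exact: measurable_sliced_optimal_atom.
apply/measurable_EFinP; apply: measurable_funM => //.
pose PQ theta := fiber_mass mu1 theta z.1 * fiber_mass mu2 theta z.2.
(* The inverse agrees with the power of exponent -1 on nonnegative reals, and that power is
   measurable. *)
have -> : (fun theta => (PQ theta)^-1) = fun theta => PQ theta `^ (-1).
  apply/funext => theta; rewrite powR_inv1//.
  by apply: mulr_ge0; apply: ltW; exact: fiber_mass_gt0.
apply: measurable_funTS; apply: (measurableT_comp (measurable_powR (-1))).
by apply: measurable_funM; exact: measurable_fiber_mass.
Qed.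

Variable sigma : probability E R.
Hypothesis sigma_sphere : sigma sphere = 1%E.
Local Open Scope ereal_scope.

Lemma expected_massE z :
  expected_mass p mu1 mu2 sigma z = \int[sigma]_(theta in sphere) lifted_mass p mu1 mu2 theta z.
Proof.
apply: eq_integral => theta _.
by rewrite /lifted_plan /= /discrete_measure esum_set1//; exact: lifted_mass_ge0.
Qed.

Lemma expected_mass0 x y : (mass mu1 x == 0%R) || (mass mu2 y == 0%R) ->
  expected_mass p mu1 mu2 sigma (x, y) = 0.
Proof.
move=> xy0; rewrite expected_massE integral0_eq// => theta _.
by rewrite /lifted_mass/= -negb_or xy0.
Qed.

Let integral_sphere_cst (r : \bar R) : 0 <= r ->
  \int[sigma]_(theta in sphere) cst r theta = r.
Proof.
move=> r0; rewrite integral_cst; last exact: measurable_sphere.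
by rewrite -[X in _ * X]/(sigma sphere) sigma_sphere mule1.
Qed.

(** If [x] is not an atom, both sides vanish. Otherwise the sum over the atoms of [mu2] passes
    inside the integral, where [lifted_row_sum] makes the integrand constant. *)
Lemma expected_row_sum x : \esum_(y in setT) expected_mass p mu1 mu2 sigma (x, y) = mu1 [set x].
Proof.
have [cA _] := atoms_discrete (@measurable_set1_tuple R d) mu2_discrete.
have [x0|x0] := eqVneq (mass mu1 x) 0%R.
  rewrite massE x0; apply: esum1 => y _.
  by rewrite expected_mass0// x0 eqxx.
rewrite (esum_support (S := atoms mu2)); last first.
  by move=> y _; rewrite atomsE => /negP; rewrite negbK => y0; rewrite expected_mass0// y0 orbT.
rewrite setTI; under eq_esum do rewrite expected_massE.
rewrite countable_esum_integral//; last 3 first.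
- exact: measurable_sphere.
- by move=> y _; exact: measurable_lifted_mass.
- by move=> y theta; exact: lifted_mass_ge0.
under eq_integral do rewrite lifted_row_sum//.
exact: integral_sphere_cst.
Qed.

Lemma expected_column_sum y : \esum_(x in setT) expected_mass p mu1 mu2 sigma (x, y) = mu2 [set y].
Proof.
have [cA _] := atoms_discrete (@measurable_set1_tuple R d) mu1_discrete.
have [y0|y0] := eqVneq (mass mu2 y) 0%R.
  rewrite massE y0; apply: esum1 => x _.
  by rewrite expected_mass0// y0 eqxx orbT.
rewrite (esum_support (S := atoms mu1)); last first.
  by move=> x _; rewrite atomsE => /negP; rewrite negbK => x0; rewrite expected_mass0// x0.
rewrite setTI; under eq_esum do rewrite expected_massE.
rewrite countable_esum_integral//; last 3 first.
- exact: measurable_sphere.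
- by move=> x _; exact: measurable_lifted_mass.
- by move=> x theta; exact: lifted_mass_ge0.
under eq_integral do rewrite lifted_column_sum//.
exact: integral_sphere_cst.
Qed.

(** Each atom in [mu1 A] is replaced by its row sum; the iterated sum is then one sum over the
    cylinder above [A]. *)
Lemma expected_plan_fst (A : set E) : measurable A ->
  expected_sliced_plan p mu1 mu2 sigma (fst @^-1` A) = mu1 A.
Proof.
move=> mA; rewrite (measure_discrete (@measurable_set1_tuple R d) mu1_discrete)//.
under eq_esum do rewrite -expected_row_sum.
rewrite (esum_esum (a := fun x y => expected_mass p mu1 mu2 sigma (x, y))); last first.
  by move=> x y _ _; exact: expected_mass_ge0.
rewrite /expected_sliced_plan /= /discrete_measure.
rewrite (_ : fst @^-1` A = A `*`` (fun=> setT)); last by apply/seteqP; split => z //= [].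
by apply: eq_esum => -[].
Qed.

Lemma expected_plan_snd (B : set E) : measurable B ->
  expected_sliced_plan p mu1 mu2 sigma (snd @^-1` B) = mu2 B.
Proof.
move=> mB; rewrite (measure_discrete (@measurable_set1_tuple R d) mu2_discrete)//.
under eq_esum do rewrite -expected_column_sum.
rewrite (esum_esum (a := fun y x => expected_mass p mu1 mu2 sigma (x, y))); last first.
  by move=> x y _ _; exact: expected_mass_ge0.
rewrite /expected_sliced_plan /= /discrete_measure.
(* The iterated sum runs over [y] first, so the coordinates are swapped to match the expected
   plan. *)
rewrite (reindex_esum (snd @^-1` B) (B `*`` (fun=> setT)) (fun z => (z.2, z.1)))//; last split.
- by apply: eq_esum => -[].
- by move=> z /= Bz; split.
- by move=> [x y] [x' y'] _ _ [-> ->].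
- by move=> [y x] [/= By _]; exists (x, y).
Qed.

End expected_plan.

Unset Implicit Arguments.

Theorem lemmaA5 (R : realType) (d : nat) (p : R) (hp : 1 < p)
    (sigma : probability (d.-tuple R) R) (hsigma : sigma sphere = 1%E)
    (mu1 mu2 : probability (d.-tuple R) R)
    (hmu1 : is_discrete mu1) (hmu2 : is_discrete mu2)
    (hm1 : finite_moment p mu1) (hm2 : finite_moment p mu2) :
  coupling mu1 mu2 (expected_sliced_plan p mu1 mu2 sigma).
Proof.
split=> [|A mA|B mB].
- rewrite -(preimage_setT fst) (expected_plan_fst hp hmu1 hmu2 hm1 hm2 hsigma)//.
  exact: probability_setT.
- exact: (expected_plan_fst hp hmu1 hmu2 hm1 hm2 hsigma).
- exact: (expected_plan_snd hp hmu1 hmu2 hm1 hm2 hsigma).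
Qed.
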